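(* Let $\rho$ be a quantum state on a complex Hilbert space $\mathcal{H}$ of finite dimension $d$, and let $\mathcal{M}=\{|m_i\rangle\langle m_i|\}_{i=1}^d$ be the projective measurement in an orthonormal basis $\{|m_i\rangle\}_{i=1}^d$ of $\mathcal{H}$. Then $$P_{\mathrm{guess}}(\rho,\mathcal{M})=\frac1d\left(\operatorname{tr}\sqrt\rho\right)^2$$ if and only if $$\langle m_i|\sqrt\rho|m_i\rangle=\frac1d\operatorname{tr}\sqrt\rho\quad\text{for all } i=1,\dots,d .$$
   Context: A quantum state on $\mathcal{H}$ is a positive semidefinite operator of trace one; $\sqrt\rho$ is its positive semidefinite square root. For a state $\rho$ and a measurement $\mathcal{M}=\{M_i\}_i$, the guessing probability is $$P_{\mathrm{guess}}(\rho,\mathcal{M})=\max_{\{\rho_i\}_i}\ \sum_i\operatorname{tr}(M_i\rho_i),$$ the maximum being over families of operators indexed like $\mathcal{M}$ with $\rho_i\ge 0$ for all $i$ and $\sum_i\rho_i=\rho$. *)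

(* Defs.v *)
(* Operators on the Hilbert space C^d are matrices 'M[C]_d
   acting on column vectors 'cV[C]_d, with <u|v> = u^t* *m v. *)
From mathcomp Require Import all_boot all_order all_algebra.
From mathcomp Require Export sesquilinear spectral.
From mathcomp Require Export reals complex.
From mathcomp Require Import ring.

Set Implicit Arguments.
Unset Strict Implicit.
Unset Printing Implicit Defensive.

Import Order.TTheory GRing.Theory Num.Theory Num.Def.
Local Open Scope ring_scope.
Local Open Scope sesquilinear_scope.

Definition expectation (C : numClosedFieldType) d (A : 'M[C]_d) (v : 'cV[C]_d) : C :=
  (v ^t* *m A *m v) 0 0.

(* The order of a numClosedFieldType makes [0 <= z] entail that z is real. *)
Definition psdmx (C : numClosedFieldType) d (A : 'M[C]_d) : Prop :=
  A \is hermsymmx /\ forall v : 'cV[C]_d, 0 <= expectation A v.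

Definition quantum_state (C : numClosedFieldType) d (rho : 'M[C]_d) : Prop :=
  psdmx rho /\ \tr rho = 1.

(* Functional calculus on a spectral decomposition of A.  For A positive
   semidefinite this is the positive semidefinite square root of A: see
   psdmx_sqrtmx, sqrtmxK and sqrtmx_unique below. *)
Definition sqrtmx (C : numClosedFieldType) d (A : 'M[C]_d) : 'M[C]_d :=
  invmx (spectralmx A) *m diag_mx (map_mx sqrtC (spectral_diag A)) *m spectralmx A.

Definition orthonormal_basis (C : numClosedFieldType) d (m : 'I_d -> 'cV[C]_d) : Prop :=
  forall i j, ((m i) ^t* *m m j) 0 0 = (i == j)%:R.

Definition basis_measurement (C : numClosedFieldType) d (m : 'I_d -> 'cV[C]_d) :
    'I_d -> 'M[C]_d :=
  fun i => m i *m (m i) ^t*.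

Definition decomposition (C : numClosedFieldType) d (I : finType)
    (rho : 'M[C]_d) (rho_ : I -> 'M[C]_d) : Prop :=
  (forall i, psdmx (rho_ i)) /\ \sum_i rho_ i = rho.

Definition guess_score (C : numClosedFieldType) d (I : finType)
    (M rho_ : I -> 'M[C]_d) : C :=
  \sum_i \tr (M i *m rho_ i).

(* [is_guess_prob rho M p] reads P_guess(rho, M) = p: the value p is the
   maximum, attained, of the scores over all decompositions of rho. *)
Definition is_guess_prob (C : numClosedFieldType) d (I : finType)
    (rho : 'M[C]_d) (M : I -> 'M[C]_d) (p : C) : Prop :=
  (exists2 rho_ : I -> 'M[C]_d, decomposition rho rho_ & guess_score M rho_ = p) /\
  (forall rho_ : I -> 'M[C]_d, decomposition rho rho_ -> guess_score M rho_ <= p).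

Lemma is_guess_prob_inj (C : numClosedFieldType) d (I : finType)
    (rho : 'M[C]_d) (M : I -> 'M[C]_d) (p q : C) :
  is_guess_prob rho M p -> is_guess_prob rho M q -> p = q.
Proof.
move=> [[f fd <-] fM] [[g gd <-] gM].
by apply/eqP; rewrite eq_le gM // fM.
Qed.

Lemma expectation_diag (C : numClosedFieldType) d (D : 'rV[C]_d) (P : 'M[C]_d)
    (v : 'cV[C]_d) :
  expectation (P ^t* *m diag_mx D *m P) v =
  \sum_i D 0 i * `|(P *m v) i 0| ^+ 2.
Proof.
rewrite /expectation !mulmxA -mulmxA.
have -> : v ^t* *m P ^t* = (P *m v) ^t* by rewrite trmx_mul map_mxM.
rewrite -mulmxA mul_diag_mx mxE; apply: eq_bigr => i _.
by rewrite !mxE normCK; ring.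
Qed.

Lemma psdmx_diag (C : numClosedFieldType) d (D : 'rV[C]_d) (P : 'M[C]_d) :
  (forall i, 0 <= D 0 i) -> psdmx (P ^t* *m diag_mx D *m P).
Proof.
move=> D0; split; last first.
  move=> v; rewrite expectation_diag; apply: sumr_ge0 => i _.
  by rewrite mulr_ge0 ?exprn_ge0.
apply/is_hermitianmxP; rewrite expr0 scale1r.
rewrite !trmx_mul !map_mxM trmxCK tr_diag_mx map_diag_mx mulmxA.
congr (_ *m diag_mx _ *m _).
apply/rowP => i; rewrite !mxE; apply/esym/CrealP; exact: ger0_real.
Qed.

Lemma psdmx_spectral (C : numClosedFieldType) d (A : 'M[C]_d) : psdmx A ->
  A = (spectralmx A) ^t* *m diag_mx (spectral_diag A) *m spectralmx A /\
  (forall i, 0 <= spectral_diag A 0 i).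
Proof.
move=> [Ah A0]; set P := spectralmx A; set D := spectral_diag A.
have PU : P \is unitarymx := spectral_unitarymx A.
have AE : A = P ^t* *m diag_mx D *m P.
  by rewrite -invmx_unitary //; apply/orthomx_spectralP/hermitian_normalmx.
split=> // i; have := A0 (P ^t* *m delta_mx i 0).
rewrite AE expectation_diag mulmxA (unitarymxP PU) mul1mx.
rewrite (bigD1 i) //= big1 ?addr0; last first.
  by move=> j ji; rewrite mxE (negPf ji) normr0 expr0n mulr0.
by rewrite mxE !eqxx normr1 expr1n mulr1.
Qed.

Lemma psdmx_sqrtmx (C : numClosedFieldType) d (A : 'M[C]_d) :
  psdmx A -> psdmx (sqrtmx A).
Proof.
move=> /psdmx_spectral[_ D0].
rewrite /sqrtmx invmx_unitary ?spectral_unitarymx //; apply: psdmx_diag => i.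
by rewrite mxE sqrtC_ge0.
Qed.

Lemma diag_mx_sqrtC (C : numClosedFieldType) d (D : 'rV[C]_d) :
  diag_mx (map_mx sqrtC D) *m diag_mx (map_mx sqrtC D) = diag_mx D.
Proof.
rewrite mulmx_diag; congr diag_mx.
by apply/rowP => i; rewrite !mxE -expr2 sqrtCK.
Qed.

Lemma sqrtmxK (C : numClosedFieldType) d (A : 'M[C]_d) :
  psdmx A -> sqrtmx A *m sqrtmx A = A.
Proof.
move=> Apsd; rewrite /sqrtmx !mulmxA mulmxK ?spectral_unit //.
rewrite -(mulmxA (invmx _)) diag_mx_sqrtC.
by case: Apsd => Ah _; apply/esym/orthomx_spectralP/hermitian_normalmx.
Qed.

Lemma sqrtmx_unique (C : numClosedFieldType) d (A S : 'M[C]_d) :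
  psdmx S -> S *m S = A -> S = sqrtmx A.
Proof.
suff psd_inj (X Y : 'M[C]_d) : psdmx X -> psdmx Y -> X *m X = Y *m Y -> X = Y.
  move=> Spsd SA.
  have Apsd : psdmx A.
    move: (spectral_unitarymx S) (psdmx_spectral Spsd) => + [].
    rewrite -SA; move: (spectralmx S) (spectral_diag S) => P D PU -> D0.
    rewrite !mulmxA mulmxtVK // -(mulmxA (P ^t*)) mulmx_diag.
    by apply: psdmx_diag => i; rewrite mxE mulr_ge0.
  by apply: psd_inj => //; [exact: psdmx_sqrtmx | rewrite sqrtmxK].
move=> /psdmx_spectral[XE X0] /psdmx_spectral[YE Y0].
move: (spectral_unitarymx X) (spectral_unitarymx Y) XE YE X0 Y0.
move: (spectralmx X) (spectralmx Y) (spectral_diag X) (spectral_diag Y).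
move=> P Q D E PU QU -> -> D0 E0.
rewrite !mulmxA !mulmxtVK // -(mulmxA (P ^t*)) -(mulmxA (Q ^t*)) !mulmx_diag.
move=> /(congr1 (fun Z => P *m Z *m Q ^t*)).
rewrite !mulmxA !(unitarymxP PU) !mul1mx mulmxtVK // => DE.
suff W : diag_mx D *m (P *m Q ^t*) = P *m Q ^t* *m diag_mx E.
  move: W => /(congr1 (fun Z => P ^t* *m Z *m Q)).
  have PK : P ^t* *m P = 1%:M by rewrite -invmx_unitary // mulVmx ?unitarymx_unit.
  have QK : Q ^t* *m Q = 1%:M by rewrite -invmx_unitary // mulVmx ?unitarymx_unit.
  by rewrite !mulmxA PK mul1mx -(mulmxA _ (Q ^t*)) QK mulmx1.
rewrite -mulmxA in DE; move: DE; move: (P *m Q ^t*) => W DE.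
apply/matrixP => i j; move: DE => /matrixP/(_ i j).
rewrite !mul_diag_mx !mul_mx_diag !mxE.
have [->|W0] := eqVneq (W i j) 0; first by rewrite !mulr0 !mul0r.
rewrite [RHS]mulrC => /(mulIf W0) /eqP; rewrite -!expr2 eqrXn2 // => /eqP ->.
by rewrite mulrC.
Qed.

(* Main.v *)
(* Write S for the square root of rho and a_i = <m_i|S|m_i>, so that the a_i sum
   to tr S.  The decomposition rho_i = S |m_i><m_i| S scores sum_i a_i^2, which
   is at least (tr S)^2 / d, with equality only if all a_i are equal; hence if
   P_guess = (tr S)^2 / d, the a_i are equal.  Conversely, in an eigenbasis e_k
   of S with eigenvalues s_k, Cauchy-Schwarz gives
     <m_i|rho_i|m_i> <= a_i * sum_k <e_k|rho_i|e_k> / s_k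
   for every decomposition; if all a_i equal a, summing over i bounds the score
   by a * sum_k s_k^2 / s_k = a tr S. *)
Require Import Defs.
From mathcomp Require Import all_boot all_order all_algebra.
From mathcomp Require Import sesquilinear spectral reals complex.
From mathcomp Require Import ring.

Set Implicit Arguments.
Unset Strict Implicit.
Unset Printing Implicit Defensive.

Import Order.TTheory GRing.Theory Num.Theory.
Local Open Scope ring_scope.
Local Open Scope sesquilinear_scope.

(** Cauchy-Schwarz for the vectors with entries x_k / sqrt(s_k) and sqrt(s_k) y_k^*. Where s_k = 0,
    x_k vanishes too, so the default [0^-1 = 0] does no harm. *)
Lemma weighted_CauchySchwarz (C : numClosedFieldType) (n : nat)
    (s x y : 'I_n -> C) :
  (forall k, 0 <= s k) -> (forall k, s k = 0 -> x k = 0) ->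
  `|\sum_k x k * y k| ^+ 2 <=
    (\sum_k (s k)^-1 * `|x k| ^+ 2) * (\sum_k s k * `|y k| ^+ 2).
Proof.
move=> s0 x0.
pose u : 'rV[C]_n := \row_k ((sqrtC (s k))^-1 * x k).
pose v : 'rV[C]_n := \row_k (sqrtC (s k) * (y k)^*).
have r0 k : 0 <= sqrtC (s k) by rewrite sqrtC_ge0.
have rK k : `|sqrtC (s k)| ^+ 2 = s k by rewrite ger0_norm // sqrtCK.
have [+ _] := CauchySchwarz (@dotmx C n) u v.
rewrite /= !dotmxE !mxE; congr (`|_| ^+ 2 <= _ * _); apply: eq_bigr => k _.
- rewrite !mxE rmorphM /= conjCK (CrealP (ger0_real (r0 k))).
  have [sk0|sk0] := eqVneq (s k) 0; first by rewrite x0 // mulr0 !mul0r.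
  by rewrite -mulrA mulrCA (mulrA (_^-1)) mulVf ?sqrtC_eq0 // mul1r.
- by rewrite !mxE -normCK normrM exprMn normfV exprVn rK.
- by rewrite !mxE -normCK normrM exprMn norm_conjC rK.
Qed.

(** * Gram factorizations of positive semidefinite matrices *)

Lemma adjmxM (C : numClosedFieldType) m n p (A : 'M[C]_(m, n)) (B : 'M[C]_(n, p)) :
  (A *m B) ^t* = B ^t* *m A ^t*.
Proof. by rewrite trmx_mul map_mxM. Qed.

Lemma gram_expectation (C : numClosedFieldType) d (B : 'M[C]_d) (v : 'cV[C]_d) :
  expectation (B ^t* *m B) v = \sum_j `|(B *m v) j 0| ^+ 2.
Proof.
rewrite /expectation !mulmxA -adjmxM -mulmxA mxE.
by move: (B *m v) => w; apply: eq_bigr => j _; rewrite !mxE normCKC.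
Qed.

Lemma psdmx_gramP (C : numClosedFieldType) d (A : 'M[C]_d) :
  psdmx A <-> exists B : 'M[C]_d, A = B ^t* *m B.
Proof.
split=> [Apsd|[B ->]].
  have [/is_hermitianmxP + _] := psdmx_sqrtmx Apsd.
  rewrite expr0 scale1r => SE.
  by exists (sqrtmx A); rewrite -[X in X *m _]SE sqrtmxK.
rewrite -[X in X *m _]mulmx1 -diag_const_mx; apply: psdmx_diag => i.
by rewrite mxE ler01.
Qed.

Lemma psdmx_adj (C : numClosedFieldType) d (A : 'M[C]_d) : psdmx A -> A ^t* = A.
Proof. by move=> /psdmx_gramP[B ->]; rewrite adjmxM trmxCK. Qed.

Lemma psdmx_congr (C : numClosedFieldType) d (A P : 'M[C]_d) :
  psdmx A -> psdmx (P *m A *m P ^t*).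
Proof.
move=> /psdmx_gramP[B ->]; apply/psdmx_gramP; exists (B *m P ^t*).
by rewrite adjmxM trmxCK !mulmxA.
Qed.

Lemma gram_diag (C : numClosedFieldType) d (B : 'M[C]_d) k :
  (B ^t* *m B) k k = \sum_j `|B j k| ^+ 2.
Proof. by rewrite mxE; apply: eq_bigr => j _; rewrite !mxE normCKC. Qed.

Lemma psdmx_diag_ge0 (C : numClosedFieldType) d (A : 'M[C]_d) k :
  psdmx A -> 0 <= A k k.
Proof.
by move=> /psdmx_gramP[B ->]; rewrite gram_diag sumr_ge0 // => j _; rewrite exprn_ge0.
Qed.

(* The vanishing hypothesis puts the support of A inside that of diag(s), so
   the junk value 0^-1 = 0 plays the role of a pseudo-inverse. *)
Lemma expectation_le_weighted (C : numClosedFieldType) d (A : 'M[C]_d)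
    (s : 'I_d -> C) (v : 'cV[C]_d) :
  psdmx A -> (forall k, 0 <= s k) -> (forall k, s k = 0 -> A k k = 0) ->
  expectation A v <=
    (\sum_k (s k)^-1 * A k k) * (\sum_k s k * `|v k 0| ^+ 2).
Proof.
move=> /psdmx_gramP[B ->] s0 A0.
(* A diagonal entry of [B ^t* *m B] is the squared norm of a column of [B], so a zero entry kills
   that column. *)
have B0 j k : s k = 0 -> B j k = 0.
  move=> /A0/eqP; rewrite gram_diag psumr_eq0 => [|i _]; last by rewrite exprn_ge0.
  by move=> /allP/(_ j); rewrite mem_index_enum expf_eq0 normr_eq0 => /(_ isT)/eqP.
rewrite gram_expectation.
under [X in _ <= X * _]eq_bigr do rewrite gram_diag mulr_sumr.
(* The bound holds separately for each row [j] of [B]. *)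
rewrite exchange_big mulr_suml; apply: ler_sum => j _; rewrite mxE.
by apply: weighted_CauchySchwarz => // k; apply: B0.
Qed.

Lemma expectation_sum (C : numClosedFieldType) d (I : finType)
    (A : I -> 'M[C]_d) (v : 'cV[C]_d) :
  expectation (\sum_i A i) v = \sum_i expectation (A i) v.
Proof. by rewrite /expectation mulmx_sumr mulmx_suml summxE. Qed.

(** * Decompositions scored against an orthonormal basis *)

Section Basis.
Variables (C : numClosedFieldType) (d : nat) (m : 'I_d -> 'cV[C]_d).
Hypothesis hm : orthonormal_basis m.

(** Orthonormality says that the square matrix U of columns [m i] has a left inverse U^*; this is
    then also a right inverse, which is completeness. *)
Lemma basis_measurement_sum1 : \sum_i basis_measurement m i = 1%:M.
Proof.
pose U : 'M[C]_d := \matrix_(j, i) m i j 0.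
have UU : U ^t* *m U = 1%:M.
  apply/matrixP => i j; rewrite !mxE -hm mxE.
  by apply: eq_bigr => k _; rewrite !mxE.
rewrite -(mulmx1C UU); apply/matrixP => i j; rewrite summxE mxE.
by apply: eq_bigr => k _; rewrite mxE big_ord1 !mxE.
Qed.

Lemma mxtrace_basis_measurement (A : 'M[C]_d) i :
  \tr (basis_measurement m i *m A) = expectation A (m i).
Proof. by rewrite -mulmxA mxtrace_mulC trace_mx11. Qed.

Lemma sum_expectation_basis (A : 'M[C]_d) : \sum_i expectation A (m i) = \tr A.
Proof.
rewrite -[in RHS](mul1mx A) -basis_measurement_sum1 mulmx_suml raddf_sum /=.
by apply: eq_bigr => i _; rewrite mxtrace_basis_measurement.
Qed.

Lemma guess_score_basis (rho_ : 'I_d -> 'M[C]_d) :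
  guess_score (basis_measurement m) rho_ = \sum_i expectation (rho_ i) (m i).
Proof. by apply: eq_bigr => i _; rewrite mxtrace_basis_measurement. Qed.

(** For invertible positive [S], this is the ensemble whose pretty good measurement is the basis
    measurement itself. *)
Definition pretty_good (S : 'M[C]_d) (i : 'I_d) : 'M[C]_d :=
  S *m basis_measurement m i *m S.

Lemma pretty_good_decomposition (S : 'M[C]_d) :
  psdmx S -> decomposition (S *m S) (pretty_good S).
Proof.
move=> Spsd; split=> [i|]; last first.
  by rewrite -mulmx_suml -mulmx_sumr basis_measurement_sum1 mulmx1.
rewrite /pretty_good -[X in _ *m X](psdmx_adj Spsd).
(* A projector is its own Gram factor. *)
apply/psdmx_congr/psdmx_gramP; exists (basis_measurement m i).
rewrite /basis_measurement adjmxM trmxCK !mulmxA -(mulmxA (m i) _ (m i)).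
by rewrite [X in _ *m X *m _]mx11_scalar hm eqxx mulmx1.
Qed.

Lemma pretty_good_score (S : 'M[C]_d) :
  guess_score (basis_measurement m) (pretty_good S) =
  \sum_i expectation S (m i) ^+ 2.
Proof.
rewrite guess_score_basis; apply: eq_bigr => i _.
rewrite /expectation /pretty_good /basis_measurement !mulmxA -mulmxA.
by rewrite -mulmxA (mulmxA _ S) mxE big_ord1.
Qed.

Lemma guess_score_le_mxtrace (S : 'M[C]_d) (a : C) (rho_ : 'I_d -> 'M[C]_d) :
  psdmx S -> (forall i, expectation S (m i) = a) ->
  decomposition (S *m S) rho_ ->
  guess_score (basis_measurement m) rho_ <= a * \tr S.
Proof.
move=> Spsd Sa [rho_psd rho_sum].
have PU := spectral_unitarymx S; have [SE s0] := psdmx_spectral Spsd.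
move: (spectralmx S) (spectral_diag S) PU SE s0 => P s PU SE s0.
have PK : P ^t* *m P = 1%:M by rewrite -invmx_unitary // mulVmx ?unitarymx_unit.
(* [A i] is [rho_ i] written in the eigenbasis of [S]. *)
pose A i := P *m rho_ i *m P ^t*.
have Apsd i : psdmx (A i) by apply: psdmx_congr.
have sumA k : \sum_i A i k k = s 0 k * s 0 k.
  have -> : \sum_i A i k k = (\sum_i A i) k k by rewrite summxE.
  rewrite -mulmx_suml -mulmx_sumr rho_sum SE !mulmxA (unitarymxP PU) mul1mx.
  by rewrite !mulmxtVK // mulmx_diag !mxE eqxx.
(* Nonnegative entries summing to s_k^2 = 0 all vanish: this is the support condition of
   [expectation_le_weighted]. *)
have A0 i k : s 0 k = 0 -> A i k k = 0.
  move=> sk0; have /eqP := sumA k.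
  rewrite sk0 mulr0 psumr_eq0 => [|j _]; last exact: psdmx_diag_ge0.
  by move=> /allP/(_ i); rewrite mem_index_enum => /(_ isT)/eqP.
have trS : \tr S = \sum_k s 0 k.
  by rewrite SE mxtrace_mulC mulmxA (unitarymxP PU) mul1mx mxtrace_diag.
have rhoE i : expectation (rho_ i) (m i) = expectation (A i) (P *m m i).
  rewrite /expectation /A adjmxM !mulmxA -(mulmxA _ (P ^t*) P) PK mulmx1.
  by rewrite -(mulmxA _ (P ^t*) P) PK mulmx1.
have aE i : \sum_k s 0 k * `|(P *m m i) k 0| ^+ 2 = a.
  by rewrite -expectation_diag -SE Sa.
rewrite guess_score_basis; apply: (@le_trans _ _
    (\sum_i (\sum_k (s 0 k)^-1 * A i k k) * a)).
  apply: ler_sum => i _; rewrite rhoE -(aE i).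
  by apply: expectation_le_weighted => // k; apply: A0.
rewrite -mulr_suml mulrC exchange_big trS.
suff -> : \sum_k \sum_i (s 0 k)^-1 * A i k k = \sum_k s 0 k by [].
apply: eq_bigr => k _; rewrite -mulr_sumr sumA.
(* s_k^-1 * s_k^2 = s_k holds at s_k = 0 as well. *)
by have [->|sk0] := eqVneq (s 0 k) 0; rewrite ?mulr0 ?mulKf.
Qed.

End Basis.

(** With T the sum of the a_j, the variance identity sum_j (a_j - T/d)^2 = sum_j a_j^2 - T^2/d makes
    a sum of squares of reals nonpositive, so each term is zero. *)
Lemma eq_mean_of_sumsq_le (C : numClosedFieldType) (d : nat) (a : 'I_d -> C) :
  (forall i, 0 <= a i) ->
  \sum_i a i ^+ 2 <= d%:R^-1 * (\sum_i a i) ^+ 2 ->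
  forall i, a i = d%:R^-1 * \sum_i a i.
Proof.
move=> a0; set T := \sum_i a i => le_sq i.
(* The index [i] itself rules out d = 0. *)
have d0 : (d%:R : C) != 0 by rewrite pnatr_eq0 -lt0n (leq_ltn_trans _ (ltn_ord i)).
have T0 : 0 <= d%:R^-1 * T by rewrite mulr_ge0 ?invr_ge0 ?ler0n ?sumr_ge0.
pose b j := (a j - d%:R^-1 * T) ^+ 2.
have b0 j : 0 <= b j by rewrite /b real_exprn_even_ge0 // rpredB ?ger0_real.
have sumb : \sum_j b j = \sum_j a j ^+ 2 - d%:R^-1 * T ^+ 2.
  under eq_bigr do rewrite /b sqrrB.
  rewrite big_split sumrB /= sumr_const card_ord -mulr_natr sumrMnl -mulr_suml.
  by rewrite -/T; field.
have /eqP : \sum_j b j = 0.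
  by apply/le_anti; rewrite sumr_ge0 // sumb subr_le0 le_sq.
rewrite psumr_eq0 // => /allP/(_ i); rewrite mem_index_enum => /(_ isT).
by rewrite /b expf_eq0 /= subr_eq0 => /eqP.
Qed.

Unset Implicit Arguments.

Theorem lemma2 (R : realType) (d : nat) (rho : 'M[R[i]]_d) (m : 'I_d -> 'cV[R[i]]_d)
    (hrho : quantum_state rho) (hm : orthonormal_basis m) :
  is_guess_prob rho (basis_measurement m) (d%:R^-1 * (\tr (sqrtmx rho)) ^+ 2) <->
  (forall i : 'I_d, expectation (sqrtmx rho) (m i) = d%:R^-1 * \tr (sqrtmx rho)).
Proof.
have [rho_psd _] := hrho.
have Spsd := psdmx_sqrtmx rho_psd.
have := pretty_good_decomposition hm Spsd; rewrite sqrtmxK // => pg_dec.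
(* Maximality is tested on the pretty good decomposition. *)
split=> [[_ /(_ _ pg_dec)]|eq_mean].
  rewrite pretty_good_score -(sum_expectation_basis hm) => le_sq.
  by apply: eq_mean_of_sumsq_le => // i; case: Spsd.
split=> [|rho_ dec].
  exists (pretty_good m (sqrtmx rho)) => //; rewrite pretty_good_score.
  under eq_bigr do rewrite expr2 {1}eq_mean.
  by rewrite -mulr_sumr sum_expectation_basis // -mulrA -expr2.
(* Regrouping as (tr S / d) * tr S exhibits the common expectation as the factor [a]. *)
rewrite expr2 mulrA; apply: guess_score_le_mxtrace => //.
by rewrite sqrtmxK.
Qed.
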